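(* Let $X$ be a real Banach space with dual $X^*$. The following statements are equivalent: (i) $X^*$ admits an equivalent dual rotund norm; (ii) $X^*$ admits an equivalent dual norm such that its unit sphere with the weak$^*$ topology, $(S_{X^*},w^* )$, has a $\mathcal{G}_\delta$-diagonal; (iii) $X^*$ admits an equivalent dual norm such that there is a symmetric $\rho$ on $S_{X^*}$ with the property that for every $x^*\in S_{X^*}$ and every $\varepsilon>0$ there is a neighbourhood of $x^*$ in $(S_{X^*},w^* )$ of $\rho$-diameter less than $\varepsilon$; (iv) $X^*$ admits an equivalent dual norm such that $(S_{X^*},w^* )$ has property $( * )$ witnessed by a sequence of families $(\mathcal{U}_n)_{n\in\mathbb{N}}$ such that every $\mathcal{U}_n$ is a covering of $S_{X^*}$; (v) $(B_{X^*},w^* )$ has property $( * )$ with slices.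
   Context: An equivalent dual norm on $X^*$ is a norm that is the dual norm of some equivalent norm on $X$ (equivalently, an equivalent $w^*$-lower semicontinuous norm). In (ii)-(iv), $S_{X^*}$ is the unit sphere of the new norm. In (v), $B_{X^*}$ is the closed unit ball of $X^*$. A norm is rotund (strictly convex) if $\|x\|=\|y\|=\|(x+y)/2\|$ implies $x=y$. A topological space $T$ has a $\mathcal{G}_\delta$-diagonal if $\{(x,x):x\in T\}$ is a $\mathcal{G}_\delta$ subset of $T\times T$. A symmetric on a nonempty set $T$ is a function $\rho:T\times T\to[0,+\infty)$ with $\rho(x,y)=\rho(y,x)$ for all $x,y\in T$, and $\rho(x,y)=0$ if and only if $x=y$ (no triangle inequality is assumed, and no relation with the topology is assumed). The $\rho$-diameter of $D\subseteq T$ is $\sup\{\rho(x,y):x,y\in D\}$. A topological space $A$ has property $( * )$ if there is a sequence $(\mathcal{U}_n)_{n\in\mathbb{N}}$ of families of open subsets of $A$ such that, given any $x,y\in A$, there exists $n_0\in\mathbb{N}$ such that: (a) $\{x,y\}\cap\bigcup\mathcal{U}_{n_0}\neq\emptyset$, where $\bigcup\mathcal{U}_{n_0}=\bigcup\{U:U\in\mathcal{U}_{n_0}\}$; and (b) for every $U\in\mathcal{U}_{n_0}$ the set $\{x,y\}\cap U$ is at most a singleton. If $A$ is a subset of a topological vector space and all elements of $\bigcup_{n}\mathcal{U}_n$ can be taken to be slices of $A$ (intersections of $A$ with open half-spaces), then $A$ has $( * )$ with slices. For $(B_{X^*},w^* )$ the slices are the sets $\{x^*\in B_{X^*}:x^*(x)>\alpha\}$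 with $x\in X$, $x\ne 0$, $\alpha\in\mathbb{R}$. *)

(* Defs.v *)
From HB Require Import structures.
From mathcomp Require Export all_boot all_order all_algebra.
From mathcomp Require Export all_classical all_reals all_analysis.
From mathcomp Require Export borel_hierarchy.
Export Order.TTheory GRing.Theory Num.Theory.
Export numFieldNormedType.Exports.

Set Implicit Arguments.
Unset Strict Implicit.
Unset Printing Implicit Defensive.

Local Open Scope classical_set_scope.
Local Open Scope ring_scope.

Section EquivalentNorms.
Context {R : realType} {X : normedModType R}.

Definition is_norm (p : X -> R) :=
  [/\ forall x, p x = 0 -> x = 0,
      forall (a : R) x, p (a *: x) = `|a| * p x &
      forall x y, p (x + y) <= p x + p y].

Definition equivalent_norm (p : X -> R) :=
  is_norm p /\
  exists c C : R, [/\ 0 < c, 0 < C &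
    forall x, c * `|x| <= p x /\ p x <= C * `|x|].

(* X^* is a subset of the space R^X with the product topology; the topology
   that it and its subsets inherit from R^X is the weak* topology. *)
Definition dual : set {ptws X -> R} :=
  [set f : {ptws X -> R} | scalar (f : X -> R) /\ continuous (f : X -> R)].

(* The supremum is finite when f is in the dual and p is an equivalent norm. *)
Definition dual_norm (p : X -> R) (f : {ptws X -> R}) : R :=
  sup [set `|f x| | x in [set x | p x <= 1]].

(* Only the values of q on the dual matter, here and below. *)
Definition equivalent_dual_norm (q : {ptws X -> R} -> R) :=
  exists2 p : X -> R, equivalent_norm p &
    forall f, dual f -> q f = dual_norm p f.

Definition rotund (q : {ptws X -> R} -> R) :=
  forall f g, dual f -> dual g ->
    q f = q g -> q g = q (fun x => (f x + g x) / 2) -> f = g.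

Definition dual_sphere (q : {ptws X -> R} -> R) : set {ptws X -> R} :=
  dual `&` [set f | q f = 1].

End EquivalentNorms.

Definition dual_ball {R : realType} (X : normedModType R) : set {ptws X -> R} :=
  dual `&` [set f | dual_norm (fun x : X => `|x|) f <= 1].
Arguments dual_ball {R} X.

Definition Gdelta_diagonal (T : topologicalType) :=
  Gdelta (@diagonal T).

Section Symmetric.
Context {R : realType} {T : Type}.

Definition symmetric_on (rho : T -> T -> R) :=
  [/\ forall x y, 0 <= rho x y,
      forall x y, rho x y = rho y x &
      forall x y, rho x y = 0 <-> x = y].

Definition rho_diameter (rho : T -> T -> R) (D : set T) : \bar R :=
  ereal_sup [set (rho x y)%:E | x in D & y in D].

End Symmetric.

Section PropertyStar.
Context {A : topologicalType}.

(* The two points need not be distinct, so each point of A is covered by some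
   U n. *)
Definition star_sequence (U : (set (set A))^nat) :=
  (forall n V, U n V -> open V) /\
  forall x y : A, exists n,
    ([set x; y] `&` \bigcup_(V in U n) V) !=set0 /\
    forall V, U n V -> is_subset1 ([set x; y] `&` V).

End PropertyStar.

Definition slice {R : realType} (X : normedModType R) (V : set (dual_ball X)) :=
  exists2 x : X, x != 0 &
    exists a : R, V = [set f : dual_ball X | a < (set_val f : X -> R) x].

(* Main.v *)
From HB Require Import structures.
Require Import Defs.
From mathcomp Require Import ring lra finmap.

(* The hard implications are (iv) => (i) and (v) => (i); both build a dual
   rotund norm whose unit ball is a sublevel set of a sum of w*-lower
   semicontinuous convex functions ("localizers"). A localizer is a supremum,
   over a bounded family of half-spaces {f | a < f x} with attached finite sets
   ys, of max(0, f x - a)^2 + c * (sum over ys of (f y)^2). If each localizer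
   (c = 1, 1/2, 1/3, ...) of a family takes at the midpoint of f and g the mean
   of its values at f and g, and some half-space of the family contains f or g,
   then a nearly optimal half-space at the midpoint must contain both f and g,
   and its set ys cannot distinguish them (lemma localization). In (v) the
   half-spaces come from the slices and ys is empty.
   In (iv), let O be a w*-open cover of the sphere S and f in S. Choose x_k in
   the unit ball with f(x_k) > 1 - 2^-(k+1) and let y_N be the sum of the x_k
   for k < N. By w*-compactness some slice {h(y_N) >= N - 1} of the dual ball is
   covered by O: otherwise a point c of the ball outside O would satisfy
   sum_k (1 - c(x_k)) <= 1, forcing c in S. A Lebesgue number argument then
   gives finitely many ys such that two points of that slice which are close on
   all of them lie in a common member of O. *)

Set Implicit Arguments.
Unset Strict Implicit.
Unset Printing Implicit Defensive.

Local Open Scope classical_set_scope.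
Local Open Scope ring_scope.

(** * Bounded linear functionals and dual norms *)

Section DualSpace.
Context {R : realType} {X : normedModType R}.
Implicit Types (f g h : {ptws X -> R}) (p : X -> R) (x y : X).

Lemma scalarD f x y : scalar (f : X -> R) -> f (x + y) = f x + f y.
Proof. by move=> sf; have := sf 1 x y; rewrite scale1r mul1r. Qed.

Lemma scalar0 f : scalar (f : X -> R) -> f 0 = 0.
Proof.
move=> sf; have := scalarD 0 0 sf; rewrite addr0 => /eqP.
by rewrite -[X in X == _]addr0 (inj_eq (addrI _)) eq_sym => /eqP.
Qed.

Lemma scalarZ f (a : R) x : scalar (f : X -> R) -> f (a *: x) = a * f x.
Proof. by move=> sf; have := sf a x 0; rewrite addr0 (scalar0 sf) addr0. Qed.

Lemma scalarN f x : scalar (f : X -> R) -> f (- x) = - f x.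
Proof. by move=> sf; rewrite -scaleN1r (scalarZ _ _ sf) mulN1r. Qed.

Lemma dual_bounded f : dual f -> exists2 M : R, 0 < M & forall x, `|f x| <= M * `|x|.
Proof.
case=> sf cf.
pose F : {linear X -> R^o} := HB.pack (f : X -> R^o)
   (GRing.isLinear.Build R X R^o _ _ sf).
have /linear_boundedP : bounded_near F (nbhs 0).
  by apply/linear_bounded_continuous.
move=> /pinfty_ex_gt0[M M0 hM].
by exists M.
Qed.

Lemma bounded_dual f (M : R) :
  scalar (f : X -> R) -> (forall x, `|f x| <= M * `|x|) -> dual f.
Proof.
move=> sf fM; split=> //.
pose F : {linear X -> R^o} := HB.pack (f : X -> R^o)
   (GRing.isLinear.Build R X R^o _ _ sf).
suff : continuous (F : X -> R^o) by [].
apply/linear_bounded_continuous/linear_boundedP.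
exists `|M|; split; first exact: normr_real.
move=> N MN x /=.
apply: le_trans (fM x) _; apply: ler_wpM2r => //.
by apply: le_trans (ltW MN); exact: ler_norm.
Qed.

Lemma dual0 : @dual R X (fun=> 0).
Proof.
apply: (@bounded_dual _ 0) => [a x y|x]; first by rewrite mulr0 addr0.
by rewrite normr0 mul0r.
Qed.

Definition mid f g : {ptws X -> R} := fun x => (f x + g x) / 2.
Definition scl (a : R) f : {ptws X -> R} := fun x => a * f x.

Lemma dual_mid f g : dual f -> dual g -> dual (mid f g).
Proof.
move=> df dg; have [M M0 fM] := dual_bounded df; have [N N0 gN] := dual_bounded dg.
case: df => sf _; case: dg => sg _.
apply: (@bounded_dual _ (M + N)).
  by move=> a x y; rewrite /mid sf sg /=; field.
move=> x; rewrite /mid normf_div (ger0_norm (ler0n _ 2)).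
have := ler_normD (f x) (g x); have := fM x; have := gN x.
have := normr_ge0 (f x + g x); rewrite mulrDl.
lra.
Qed.

Lemma dual_scl a f : dual f -> dual (scl a f).
Proof.
move=> df; have [M M0 fM] := dual_bounded df; case: df => sf _.
apply: (@bounded_dual _ (`|a| * M)).
  by move=> b x y; rewrite /scl sf /=; ring.
by move=> x; rewrite /scl normrM -mulrA ler_wpM2l.
Qed.

Section EquivalentNorm.
Context (p : X -> R) (pN : equivalent_norm p).

Let pZ (a : R) x : p (a *: x) = `|a| * p x.
Proof. by case: pN => -[_ + _] _; apply. Qed.

Lemma norm_ge0 x : 0 <= p x.
Proof.
case: pN => _ [c [C [c0 _ h]]]; have [h1 _] := h x.
by apply: le_trans h1; rewrite mulr_ge0// ltW.
Qed.

Lemma norm_eq0 x : p x = 0 -> x = 0.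
Proof. by case: pN => -[+ _ _] _; apply. Qed.

Lemma norm0 : p 0 = 0.
Proof. by rewrite -(scale0r 0) pZ normr0 mul0r. Qed.

Lemma dual_norm_le f c : 0 <= c -> (forall x, p x <= 1 -> `|f x| <= c) ->
  dual_norm p f <= c.
Proof.
move=> c0 fc; apply: ge_sup; first by exists `|f 0|; exists 0 => //=; rewrite norm0.
by move=> _ [x /= px <-]; exact: fc.
Qed.

Lemma dual_norm_has_sup f : dual f -> has_sup [set `|f x| | x in [set x | p x <= 1]].
Proof.
move=> df; have [M M0 fM] := dual_bounded df.
case: pN => _ [c [C [c0 _ h]]].
split; first by exists `|f 0|; exists 0 => //=; rewrite norm0.
exists (M * c^-1) => _ [x /= px <-]; apply: le_trans (fM x) _.
rewrite ler_wpM2l//; first exact: ltW.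
rewrite -[leRHS]mul1r ler_pdivlMr// mulrC.
by apply: le_trans px; case: (h x).
Qed.

Lemma dual_norm_ge f x : dual f -> p x <= 1 -> `|f x| <= dual_norm p f.
Proof.
by move=> df px; apply: ub_le_sup; [case: (dual_norm_has_sup df)|exists x].
Qed.

Lemma dual_norm_ge0 f : dual f -> 0 <= dual_norm p f.
Proof.
move=> df; apply: le_trans (dual_norm_ge (x := 0) df _); first exact: normr_ge0.
by rewrite norm0.
Qed.

Lemma dual_normP f x : dual f -> `|f x| <= dual_norm p f * p x.
Proof.
move=> df; have [px0|px0] := eqVneq (p x) 0.
  by rewrite (norm_eq0 px0) (scalar0 (proj1 df)) normr0 norm0 mulr0.
have {}px0 : 0 < p x by rewrite lt_def px0 norm_ge0.
have := @dual_norm_ge f ((p x)^-1 *: x) df.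
rewrite pZ gtr0_norm ?invr_gt0// mulVf ?gt_eqF// => /(_ (lexx _)).
rewrite (scalarZ _ _ (proj1 df)) normrM gtr0_norm ?invr_gt0//.
by rewrite mulrC ler_pdivrMr.
Qed.

Lemma dual_norm_gt f c : dual f -> c < dual_norm p f ->
  exists2 x, p x <= 1 & c < f x.
Proof.
move=> df /sup_gt[]; first by case: (dual_norm_has_sup df).
move=> _ [x /= px <-]; have [fx0|fx0] := leP 0 (f x).
  by rewrite ger0_norm// => cf; exists x.
rewrite ltr0_norm// => cf; exists (- x); last by rewrite scalarN//; case: df.
by rewrite -scaleN1r pZ normrN1 mul1r.
Qed.

Lemma dual_norm_scl a f : dual f -> dual_norm p (scl a f) = `|a| * dual_norm p f.
Proof.
have H b g : dual g -> dual_norm p (scl b g) <= `|b| * dual_norm p g.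
  move=> dg; apply: dual_norm_le; first by rewrite mulr_ge0 ?dual_norm_ge0.
  by move=> x px; rewrite /scl normrM ler_wpM2l// dual_norm_ge.
move=> df; apply/eqP; rewrite eq_le H//=.
have [->|a0] := eqVneq a 0.
  by rewrite normr0 mul0r dual_norm_ge0//; exact: dual_scl.
have := H a^-1 (scl a f) (dual_scl a df).
have -> : scl a^-1 (scl a f) = f.
  by apply/funext => x; rewrite /scl mulKf.
rewrite normfV mulrC ler_pdivlMr ?normr_gt0//.
by rewrite mulrC.
Qed.

Lemma dual_norm_eq0 f : dual f -> dual_norm p f = 0 -> f = fun=> 0.
Proof.
move=> df f0; apply/funext => x; apply/eqP; rewrite -normr_le0.
by apply: le_trans (dual_normP x df) _; rewrite f0 mul0r.
Qed.

Lemma dual_norm_mid f g : dual f -> dual g ->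
  dual_norm p (mid f g) <= (dual_norm p f + dual_norm p g) / 2.
Proof.
move=> df dg; apply: dual_norm_le.
  by rewrite divr_ge0// addr_ge0// dual_norm_ge0.
move=> x px; rewrite /mid normf_div (ger0_norm (ler0n _ 2)).
have := ler_normD (f x) (g x).
have := dual_norm_ge df px; have := dual_norm_ge dg px.
lra.
Qed.

End EquivalentNorm.

Lemma equivalent_norm_normr : equivalent_norm (fun x : X => `|x|).
Proof.
split; first by split; [exact: normr0_eq0|exact: normrZ|exact: ler_normD].
by exists 1, 1; split=> // x; rewrite mul1r.
Qed.

End DualSpace.

(** * Suprema of weak* continuous affine functions, and localizers *)

Section AffineSup.
Context {R : realType} {X : normedModType R}.
Implicit Types (f g h : {ptws X -> R}) (x y : X) (Phi : {ptws X -> R} -> R).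

(* The second clause follows from the first and from Phi g <= C (1 + |g|^2) by
   the Hahn-Banach theorem; carrying it along makes that theorem unnecessary. *)
Definition minorant (C : R) Phi x (b : R) :=
  (forall g, dual g -> g x + b <= Phi g) /\
  forall B, 0 <= B -> B * `|x| + b <= C * (1 + B ^+ 2).

(** Encodes weak* lower semicontinuous convexity: on the dual, [Phi] is the supremum of affine
    functions [f x + b]. The growth constant [C] keeps suprema of families finite and bounds partial
    sums uniformly. *)
Definition affine_sup (C : R) Phi :=
  forall f, dual f -> forall e, 0 < e ->
  exists x b, minorant C Phi x b /\ Phi f - e < f x + b.

Lemma affine_sup_le C Phi f (B : R) : affine_sup C Phi -> dual f -> 0 <= B ->
  (forall x, `|f x| <= B * `|x|) -> Phi f <= C * (1 + B ^+ 2).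
Proof.
move=> aP df B0 fB; apply/ler_addgt0Pr => e e0.
have [x [b [[_ /(_ B B0) xb] fxb]]] := aP f df e e0.
have := fB x; have := ler_norm (f x); lra.
Qed.

Lemma affine_sup_mid C Phi f g : affine_sup C Phi -> dual f -> dual g ->
  Phi (mid f g) <= (Phi f + Phi g) / 2.
Proof.
move=> aP df dg; apply/ler_addgt0Pr => e e0.
have [x [b [[Pxb _]]]] := aP _ (dual_mid df dg) e e0.
have := Pxb _ df; have := Pxb _ dg; rewrite /mid; lra.
Qed.

Lemma affine_sup_weak C D Phi : C <= D -> affine_sup C Phi -> affine_sup D Phi.
Proof.
move=> CD aP f df e e0; have [x [b [[P1 P2] P3]]] := aP f df e e0.
exists x, b; split=> //; split=> // B B0.
by apply: le_trans (P2 B B0) _; apply: ler_wpM2r => //; rewrite addr_ge0 ?sqr_ge0.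
Qed.

Lemma affine_sup0 : affine_sup 0 (fun=> 0).
Proof.
move=> f df e e0; exists 0, 0; split; last by rewrite (scalar0 (proj1 df)); lra.
by split=> [g dg|B B0]; rewrite ?(scalar0 (proj1 dg)) ?normr0; lra.
Qed.

Lemma affine_supD C D Phi Psi : affine_sup C Phi -> affine_sup D Psi ->
  affine_sup (C + D) (fun f => Phi f + Psi f).
Proof.
move=> aP aQ f df e e0; have e20 : 0 < e / 2 by lra.
have [x [b [[P1 P2] P3]]] := aP f df _ e20.
have [y [c [[Q1 Q2] Q3]]] := aQ f df _ e20.
exists (x + y), (b + c); rewrite (scalarD _ _ (proj1 df)).
split; last by lra.
split=> [g dg|B B0].
  by rewrite (scalarD _ _ (proj1 dg)); have := P1 g dg; have := Q1 g dg; lra.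
have := P2 B B0; have := Q2 B B0; have := ler_wpM2l B0 (ler_normD x y); lra.
Qed.

Lemma affine_supZ w C Phi : 0 <= w -> affine_sup C Phi ->
  affine_sup (w * C) (fun f => w * Phi f).
Proof.
rewrite le_eqVlt => /predU1P[<- _|w0 aP f df e e0].
  under [X in affine_sup _ X]eq_fun do rewrite mul0r.
  by rewrite mul0r; exact: affine_sup0.
have [x [b [[P1 P2] P3]]] := aP f df _ (divr_gt0 e0 w0).
exists (w *: x), (w * b); split.
  split=> [g dg|B B0].
    by rewrite (scalarZ _ _ (proj1 dg)) -mulrDr ler_pM2l//; exact: P1.
  by rewrite normrZ gtr0_norm// mulrCA -mulrDr -mulrA ler_pM2l//; exact: P2.
rewrite (scalarZ _ _ (proj1 df)) -mulrDr.
have -> : w * Phi f - e = w * (Phi f - e / w).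
  by field; rewrite gt_eqF.
by rewrite ltr_pM2l.
Qed.

Lemma affine_sup_sum (I : Type) (r : seq I) (C : I -> R) (Phi : I -> {ptws X -> R} -> R) :
  (forall i, affine_sup (C i) (Phi i)) ->
  affine_sup (\sum_(i <- r) C i) (fun f => \sum_(i <- r) Phi i f).
Proof.
move=> aP; elim: r => [|i r IH].
  rewrite big_nil; under [X in affine_sup _ X]eq_fun do rewrite big_nil.
  exact: affine_sup0.
rewrite big_cons; under [X in affine_sup _ X]eq_fun do rewrite big_cons.
exact: affine_supD.
Qed.

Lemma affine_sup_opp C Phi : affine_sup C Phi ->
  affine_sup C (fun f => Phi (scl (-1) f)).
Proof.
move=> aP f df e e0; have [x [b [[P1 P2] P3]]] := aP _ (dual_scl (-1) df) _ e0.
exists (- x), b; split; last by move: P3; rewrite /scl (scalarN _ (proj1 df)) mulN1r.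
split=> [g dg|B B0]; last by rewrite normrN; exact: P2.
have := P1 _ (dual_scl (-1) dg).
by rewrite /scl (scalarN _ (proj1 dg)) mulN1r.
Qed.

Lemma affine_sup_sqr y : affine_sup (`|y| ^+ 2) (fun f => f y ^+ 2).
Proof.
(* The minorant is the tangent at [f y] to the square function. *)
move=> f df e e0; exists ((2 * f y) *: y), (- (f y) ^+ 2); split; last first.
  by rewrite (scalarZ _ _ (proj1 df)); lra.
split=> [g dg|B B0].
  by rewrite (scalarZ _ _ (proj1 dg)); have := sqr_ge0 (g y - f y); nra.
rewrite normrZ -(real_normK (num_real (f y))) normrM (ger0_norm (ler0n _ 2)).
have := sqr_ge0 (B * `|y| - `|f y|); have := sqr_ge0 `|y|; nra.
Qed.

Lemma affine_sup_pos_sqr x (a M : R) : `|x| <= M -> `|a| <= M ->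
  affine_sup (2 * M ^+ 2) (fun f => Num.max 0 (f x - a) ^+ 2).
Proof.
move=> xM aM f df e e0; set t := Num.max 0 (f x - a).
have t0 : 0 <= t by rewrite le_max lexx.
(* Tangent to the squared positive part at [f x - a]; for [t = 0] it is the zero function. *)
exists ((2 * t) *: x), (- (2 * t * a) - t ^+ 2); split; last first.
  rewrite (scalarZ _ _ (proj1 df)).
  suff : t * t = t * (f x - a) by lra.
  by rewrite /t; case: (leP 0 (f x - a)) => // _; rewrite !mul0r.
split=> [g dg|B B0].
  rewrite (scalarZ _ _ (proj1 dg)).
  set u := Num.max 0 _.
  have gu : g x - a <= u by rewrite le_max lexx orbT.
  have := sqr_ge0 (u - t); have := ler_wpM2l t0 gu; lra.
rewrite normrZ ger0_norm ?mulr_ge0//.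
have : B * `|x| - a <= B * M + M.
  by apply: lerD; [exact: ler_wpM2l|apply: le_trans aM; rewrite -normrN ler_norm].
move=> /(ler_wpM2l t0).
have := sqr_ge0 (t - (B * M + M)); have := sqr_ge0 (B * M - M); lra.
Qed.

Lemma affine_sup_has_sup C (I : Type) (A : set I) (Phi : I -> {ptws X -> R} -> R) f :
  (forall i, A i -> affine_sup C (Phi i)) -> A !=set0 -> dual f ->
  has_sup [set Phi i f | i in A].
Proof.
move=> aP [i0 Ai0] df; split; first by exists (Phi i0 f), i0.
have [M M0 fM] := dual_bounded df.
exists (C * (1 + M ^+ 2)) => _ [i Ai <-].
by apply: affine_sup_le fM => //; [exact: aP|exact: ltW].
Qed.

Lemma affine_sup_sup C (I : Type) (A : set I) (Phi : I -> {ptws X -> R} -> R) :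
  (forall i, A i -> affine_sup C (Phi i)) -> A !=set0 ->
  affine_sup C (fun f => sup [set Phi i f | i in A]).
Proof.
move=> aP A0 f df e e0; have e20 : 0 < e / 2 by lra.
have [_ [i Ai <-] Pi] := sup_adherent e20 (affine_sup_has_sup aP A0 df).
have [x [b [[P1 P2] P3]]] := aP i Ai f df _ e20.
exists x, b; split; last by lra.
split=> // g dg; apply: le_trans (P1 g dg) _.
by apply: sup_upper_bound; [exact: (affine_sup_has_sup aP)|exists i].
Qed.

(** A triple [(x, a, ys)] stands for the half-space of all [f] with [a < f x], with a finite list
    [ys] of test vectors attached. *)
Let triple := (X * R * seq X)%type.
Implicit Types (t : triple) (H : set triple).

Definition spread t f := \sum_(y <- t.2) f y ^+ 2.
Definition height t f := Num.max 0 (f t.1.1 - t.1.2).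

(* The zero triple makes the supremum range over a nonempty set. *)
Definition localizer (j : nat) H f :=
  sup [set height t f ^+ 2 + j.+1%:R^-1 * spread t f | t in (0, 0, [::]) |` H].

Definition triple_bounded (M : R) t :=
  [/\ `|t.1.1| <= M, `|t.1.2| <= M & \sum_(y <- t.2) `|y| ^+ 2 <= M].

Lemma localizer_term M j H t : 0 <= M -> H `<=` triple_bounded M ->
  ((0, 0, [::]) |` H) t ->
  affine_sup (2 * M ^+ 2 + M) (fun f => height t f ^+ 2 + j.+1%:R^-1 * spread t f).
Proof.
move=> M0 HM Ht; have {HM Ht}[t1 t2 t3] : triple_bounded M t.
  by case: Ht => [->|/HM//]; split => //=; rewrite ?normr0// big_nil.
apply: affine_supD; first exact: affine_sup_pos_sqr.
apply: (@affine_sup_weak (j.+1%:R^-1 * M)).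
  by rewrite -[leRHS]mul1r ler_wpM2r// invf_le1// ler1n.
apply: affine_supZ; first by rewrite invr_ge0.
apply: affine_sup_weak t3 _; apply: affine_sup_sum => y; exact: affine_sup_sqr.
Qed.

Lemma localizer_affine_sup M j H : 0 <= M -> H `<=` triple_bounded M ->
  affine_sup (2 * M ^+ 2 + M) (localizer j H).
Proof.
move=> M0 HM; apply: affine_sup_sup; last by exists (0, 0, [::]); left.
by move=> t Ht; exact: localizer_term HM Ht.
Qed.

Lemma localizer_ge M j H t f : 0 <= M -> H `<=` triple_bounded M -> dual f ->
  ((0, 0, [::]) |` H) t -> height t f ^+ 2 + j.+1%:R^-1 * spread t f <= localizer j H f.
Proof.
move=> M0 HM df Ht; apply: sup_upper_bound; last by exists t.
apply: (@affine_sup_has_sup (2 * M ^+ 2 + M) _ _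
  (fun t f => height t f ^+ 2 + j.+1%:R^-1 * spread t f)) => //.
  by move=> {Ht}t Ht; exact: localizer_term HM Ht.
by exists t.
Qed.

Lemma localizer_ge0 M j H f : 0 <= M -> H `<=` triple_bounded M -> dual f ->
  0 <= localizer j H f.
Proof.
move=> M0 HM df.
apply: le_trans (localizer_ge j M0 HM df (or_introl (erefl (0, 0, [::])))).
by rewrite addr_ge0 ?sqr_ge0// /spread big_nil mulr0.
Qed.

(** Let a and b be the suprema of the squared heights at [f] and [g]. For large [j] the spread is
    negligible at the midpoint, so a nearly optimal triple there has squared height above (a + b) /
    4, which is impossible if its height at [f] or at [g] vanishes. Strict convexity of the spread
    then bounds the distance on [ys] by the error of near-optimality. *)
Lemma localization M H f g (eta : R) t0 : 0 <= M -> H `<=` triple_bounded M ->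
  dual f -> dual g ->
  (forall j, localizer j H f + localizer j H g = 2 * localizer j H (mid f g)) ->
  0 < eta -> H t0 -> t0.1.2 < f t0.1.1 \/ t0.1.2 < g t0.1.1 ->
  exists2 t, H t & [/\ t.1.2 < f t.1.1, t.1.2 < g t.1.1 &
    \sum_(y <- t.2) (f y - g y) ^+ 2 <= eta].
Proof.
move=> M0 HM df dg eqH eta0 Ht0 fgt0.
pose A := (0, 0, [::]) |` H.
pose hs f := [set height t f ^+ 2 | t in A].
have hsup h : dual h -> has_sup (hs h).
  apply: (@affine_sup_has_sup (2 * M ^+ 2) _ _ (fun t h => height t h ^+ 2)).
    by move=> t At; apply: affine_sup_pos_sqr; case: At => [->|/HM[]]//=; rewrite normr0.
  by exists t0; right.
have hsub h t : dual h -> A t -> height t h ^+ 2 <= sup (hs h).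
  by move=> dh At; apply: sup_upper_bound; [exact: hsup|exists t].
have spread_ge0 t h : 0 <= spread t h.
  by apply: sumr_ge0 => y _; exact: sqr_ge0.
have hle h j : dual h -> sup (hs h) <= localizer j H h.
  move=> dh; apply: ge_sup; first by case: (hsup h dh).
  move=> _ [t At <-]; apply: le_trans (localizer_ge j M0 HM dh At).
  by rewrite lerDl mulr_ge0// invr_ge0.
have height_ge0 t h : 0 <= height t h by rewrite le_max lexx.
have a_ge0 : 0 <= sup (hs f).
  by apply: le_trans (hsub _ _ df (or_intror Ht0)); exact: sqr_ge0.
have b_ge0 : 0 <= sup (hs g).
  by apply: le_trans (hsub _ _ dg (or_intror Ht0)); exact: sqr_ge0.
have ab_gt0 : 0 < sup (hs f) + sup (hs g).
  have hpos h : t0.1.2 < h t0.1.1 -> dual h -> 0 < sup (hs h).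
    move=> th dh; apply: lt_le_trans (hsub _ _ dh (or_intror Ht0)).
    by rewrite exprn_gt0// lt_max subr_gt0 th orbT.
  by case: fgt0 => /hpos h; [have := h df|have := h dg]; lra.
have [B B0 fB] := dual_bounded (dual_mid df dg).
have spread_le t : A t -> spread t (mid f g) <= B ^+ 2 * M.
  move=> At; have {At} : \sum_(y <- t.2) `|y| ^+ 2 <= M.
    by case: At => [->|/HM[]//]; rewrite big_nil.
  move=> /(ler_wpM2l (sqr_ge0 B)); apply: le_trans.
  rewrite mulr_sumr; apply: ler_sum => y _.
  by rewrite -exprMn -real_normK ?num_real// ler_sqr ?nnegrE ?mulr_ge0// ltW.
(* The bound [spread_le] is uniform in the triple, so [j] can be fixed before the triple is
   chosen. *)
have [j jP] : exists j : nat, B ^+ 2 * M * j.+1%:R^-1 <= (sup (hs f) + sup (hs g)) / 8.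
  have e0 : 0 < (sup (hs f) + sup (hs g)) / 8 by lra.
  have := archi_boundP (divr_ge0 (mulr_ge0 (sqr_ge0 B) M0) (ltW e0)).
  rewrite mulrC; set j := Num.bound _ => jP; exists j.
  rewrite ler_pdivrMr// -ler_pdivrMl//.
  by apply/ltW/(lt_trans jP); rewrite ltr_nat.
set c := j.+1%:R^-1 in jP *; have c0 : 0 < c by rewrite invr_gt0.
(* The first bound on [eps] serves the heights, the second the spread. *)
pose eps := Num.min ((sup (hs f) + sup (hs g)) / 8) (eta * c / 4).
have eps0 : 0 < eps by rewrite lt_min !divr_gt0// mulr_gt0.
have epsa : eps <= (sup (hs f) + sup (hs g)) / 8 by rewrite ge_min lexx.
have epsc : eps <= eta * c / 4 by rewrite ge_min lexx orbT.
have [_ [t At <-]] := sup_adherent eps0 (@affine_sup_has_sup _ _ A _ _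
  (fun t => @localizer_term M j H t M0 HM)
  (ex_intro _ t0 (or_intror Ht0)) (dual_mid df dg)).
rewrite -/(localizer j H (mid f g)) -/c => tP.
have Ha := localizer_ge j M0 HM df At; have Hb := localizer_ge j M0 HM dg At.
have la := hle _ j df; have lb := hle _ j dg; have eqj := eqH j.
rewrite -/c in Ha Hb.
have ha := hsub _ _ df At; have hb := hsub _ _ dg At.
have hm : height t (mid f g) ^+ 2 <= ((height t f + height t g) / 2) ^+ 2.
  rewrite ler_sqr ?nnegrE ?height_ge0 ?divr_ge0 ?addr_ge0//.
  rewrite {1}/height /mid ge_max divr_ge0 ?addr_ge0//=.
  have : f t.1.1 - t.1.2 <= height t f by rewrite le_max lexx orbT.
  have : g t.1.1 - t.1.2 <= height t g by rewrite le_max lexx orbT.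
  lra.
have sm := ler_wpM2r (ltW c0) (spread_le t At).
set D := \sum_(y <- t.2) (f y - g y) ^+ 2.
(* Parallelogram identity, summed over the list. *)
have spread_mid : spread t (mid f g) = (spread t f + spread t g) / 2 - D / 4.
  rewrite /spread /D -big_split !mulr_suml -sumrB; apply: eq_bigr => y _ /=.
  by rewrite /mid; field.
(* Half of the sum of the two suprema, minus an eighth for [eps] and an eighth for the spread,
   leaves a quarter. *)
have heights : (sup (hs f) + sup (hs g)) / 4 < ((height t f + height t g) / 2) ^+ 2.
  lra.
(* A zero height at [f] would give [height t g ^+ 2 > sup (hs f) + sup (hs g)], against [hb]. *)
have uf : 0 < height t f.
  rewrite lt_def height_ge0 andbT; apply/eqP => u0; move: heights; rewrite u0; lra.
have ug : 0 < height t g.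
  rewrite lt_def height_ge0 andbT; apply/eqP => u0; move: heights; rewrite u0; lra.
have height_gt h : 0 < height t h -> t.1.2 < h t.1.1.
  by rewrite lt_max ltxx subr_gt0.
exists t; last split; [|exact: height_gt|exact: height_gt|].
  (* The added zero triple has height zero at [f], so the triple found lies in [H]. *)
  case: At => // t0E; move: uf; rewrite t0E /height /=.
  by rewrite (scalar0 (proj1 df)) subrr maxxx ltxx.
(* Comparing the midpoint with the mean of the values at [f] and [g] gives [c * D / 4 < eps], and
   [eps <= eta * c / 4]. *)
rewrite -(ler_pM2r c0) -/D.
have := mulrDr c ((spread t f + spread t g) / 2) (- (D / 4)).
rewrite -spread_mid => cs.
have := sqr_ge0 (height t f - height t g); lra.
Qed.

End AffineSup.

(** * Dual norms from sublevel sets of convex functions *)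

Section Renorming.
Context {R : realType} {X : normedModType R}.
Implicit Types (f g h : {ptws X -> R}) (x y : X) (Phi : {ptws X -> R} -> R).

Section Sublevel.
Context (s : nat -> {ptws X -> R} -> R) (D : R).
Context (sA : forall N, affine_sup (1 / 2) (s N)).
Context (s_even : forall N f, dual f -> s N (scl (-1) f) = s N f).
Context (D1 : 1 <= D).
Context (s_bounded : forall f, dual f -> (forall N, s N f <= 1) ->
  forall x, `|f x| <= D * `|x|).

Let K : set {ptws X -> R} := [set f | dual f /\ forall N, s N f <= 1].

Let P x := sup [set `|f x| | f in K].

(* The polar of the sublevel set K is already equivalent to the norm of X; the
   term |x| / 2 does not change it, but gives the lower bound directly. *)
Let p x := Num.max (P x) (`|x| / 2).

Let D0 : 0 < D. Proof. exact: lt_le_trans ltr01 D1. Qed.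

Let zeroK : K (fun=> 0).
Proof.
split=> [|N]; first exact: dual0.
apply: le_trans (affine_sup_le (B := 0) (sA N) dual0 (lexx _) _) _.
  by move=> x; rewrite normr0 mul0r.
by rewrite expr0n addr0 mulr1 ler_pdivrMr// mul1r ler1n.
Qed.

Let P_has_sup x : has_sup [set `|f x| | f in K].
Proof.
split; first by exists `|0 : R|; exists (fun=> 0) => //; exact: zeroK.
by exists (D * `|x|) => _ [f [df fK] <-]; exact: s_bounded.
Qed.

Let P_ge f x : K f -> `|f x| <= P x.
Proof. by move=> Kf; apply: sup_upper_bound => //; exists f. Qed.

Let P_le x c : (forall f, K f -> `|f x| <= c) -> P x <= c.
Proof.
move=> Kc; apply: ge_sup; first by case: (P_has_sup x).
by move=> _ [f Kf <-]; exact: Kc.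
Qed.

Let pZ_le a x : p (a *: x) <= `|a| * p x.
Proof.
rewrite ge_max normrZ -mulrA ler_wpM2l ?le_max ?lexx ?orbT// andbT.
apply: P_le => f [df Kf]; rewrite (scalarZ _ _ (proj1 df)) normrM ler_wpM2l//.
by rewrite le_max P_ge.
Qed.

Let pN : equivalent_norm p.
Proof.
have p_ge x : `|x| / 2 <= p x by rewrite le_max lexx orbT.
split; last first.
  exists (1 / 2), D; split=> // x.
  split; first by rewrite mulrC mulrA mulr1.
  rewrite ge_max; apply/andP; split; first by apply: P_le => f [? ?]; exact: s_bounded.
  by have := normr_ge0 x; have := ler_wpM2r (normr_ge0 x) D1; lra.
split.
- move=> x px; apply/eqP; rewrite -normr_le0; have := p_ge x; lra.
- move=> a x; apply/eqP; rewrite eq_le pZ_le/=.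
  have [->|a0] := eqVneq a 0.
    by rewrite normr0 mul0r; apply: le_trans (p_ge _); rewrite divr_ge0.
  have := pZ_le a^-1 (a *: x).
  by rewrite scalerA mulVf// scale1r normfV mulrC ler_pdivlMr ?normr_gt0// mulrC.
- move=> x y; rewrite ge_max; apply/andP; split.
    apply: P_le => f Kf; rewrite (scalarD _ _ (proj1 (proj1 Kf))).
    apply: le_trans (ler_normD _ _) (lerD _ _); by rewrite le_max P_ge.
  have := ler_normD x y; have := p_ge x; have := p_ge y; lra.
Qed.

(** The bipolar theorem for [K]: each minorant of [s N] puts [K] in a half-space [k x + b <= 1].
    Evenness of [s N] makes this a bound on the absolute value, that is [P x <= 1 - b], which every
    functional of norm at most 1 inherits. *)
Let dual_norm_le1 f : dual f -> dual_norm p f <= 1 <-> K f.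
Proof.
move=> df; split=> [f1|Kf]; last first.
  apply: dual_norm_le => // x; rewrite ge_max => /andP[Px _].
  exact: le_trans (P_ge _ Kf) Px.
split=> // N; apply/ler_addgt0Pr => e e0.
have [x [b [[xbs xb] fxb]]] := sA N df e0.
suff : f x + b <= 1 by lra.
(* The growth constant 1/2 at [B = 1] gives [|x| + b <= 1], so the second term of [p] is below
   [1 - b] too. *)
have := xb 1 ler01; rewrite mul1r expr1n mulfVK// => xb1.
have fx : f x <= dual_norm p f * p x := le_trans (ler_norm _) (dual_normP pN _ df).
have px : p x <= 1 - b.
  rewrite ge_max; apply/andP; split; last by have := normr_ge0 x; lra.
  apply: P_le => k [dk Kk].
  have := xbs _ dk; have := Kk N.
  have := xbs _ (dual_scl (-1) dk); rewrite (s_even _ dk) /scl mulN1r.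
  by rewrite ler_norml => *; apply/andP; split; lra.
have := norm_ge0 pN x; nra.
Qed.

(** For the last clause: if every [s N f] were at most [1 - e], then convexity along the ray through
    [f], with a bound at twice [f] uniform in [N], would keep [scl (1 + eta) f] in [K], against norm
    1. *)
Lemma sublevel_norm : exists p : X -> R, [/\ equivalent_norm p,
  forall f, dual f -> dual_norm p f <= 1 -> forall N, s N f <= 1 &
  forall f, dual f -> dual_norm p f = 1 -> forall e, 0 < e ->
    exists N, 1 - e < s N f].
Proof.
exists p; split=> [//|f df /(dual_norm_le1 df)[]//|f df f1 e e0].
apply/not_existsP => sN.
have [_ Kf] : K f by apply/dual_norm_le1; rewrite ?f1.
have fD := s_bounded df Kf.
(* [c] bounds every minorant of every [s N] at twice [f]. *)
pose c := 1 / 2 * (1 + (2 * D) ^+ 2).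
have c0 : 0 < c by rewrite /c; have := sqr_ge0 (2 * D); lra.
pose eta := Num.min 1 (e / (c + e)).
have eta0 : 0 < eta by rewrite lt_min ltr01 divr_gt0// addr_gt0.
have eta1 : eta <= 1 by rewrite ge_min lexx.
have etac : eta * (c + e) <= e.
  by rewrite -ler_pdivlMr ?addr_gt0// ge_min lexx orbT.
have : dual_norm p (scl (1 + eta) f) <= 1.
  apply/dual_norm_le1; first exact: dual_scl.
  split=> [|N]; first exact: dual_scl.
  apply/ler_addgt0Pr => d d0.
  have [x [b [[xbs xb] fxb]]] := sA N (dual_scl (1 + eta) df) d0.
  have h1 : f x + b <= 1 - e.
    by apply: le_trans (xbs _ df) _; rewrite leNgt; apply/negP/sN.
  have h2 : 2 * f x + b <= c.
    apply: le_trans (xb (2 * D) _); last by rewrite mulr_ge0// (ltW D0).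
    by have := fD x; have := ler_norm (f x); lra.
  (* [(1 + eta) * f x + b] combines [h1] and [h2] with weights [1 - eta] and [eta]. *)
  have l0 : 0 <= 1 - eta by rewrite subr_ge0.
  have := ler_wpM2l l0 h1; have := ler_wpM2l (ltW eta0) h2.
  have := mulr_ge0 (ltW eta0) (ltW e0).
  move: fxb; rewrite /scl; lra.
rewrite (dual_norm_scl pN _ df) f1 mulr1 gtr0_norm; lra.
Qed.

End Sublevel.

(** The squared dual norm and the symmetrized [Psi k] are added with summable weights, and the new
    unit ball is where all partial sums are at most 1. If [f], [g] and their midpoint have norm 1,
    partial sums at the midpoint come arbitrarily close to 1, so the convexity defect of each
    [Psi k] vanishes. *)
Lemma rotund_renorming (Psi : nat -> {ptws X -> R} -> R) (C : nat -> R) :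
  (forall k, 0 < C k) -> (forall k, affine_sup (C k) (Psi k)) ->
  (forall k f, dual f -> 0 <= Psi k f) ->
  (forall f g, dual f -> dual g ->
    (forall x, `|f x| <= 5 * `|x|) -> (forall x, `|g x| <= 5 * `|x|) ->
    (forall k, Psi k f + Psi k g = 2 * Psi k (mid f g)) -> f = g) ->
  exists2 q : {ptws X -> R} -> R, equivalent_dual_norm q & rotund q.
Proof.
move=> C0 PsiA Psi0 sep.
(* [localizer 0 B] is the square of the dual norm; it makes the sublevel set bounded. *)
pose B : set (X * R * seq X) := [set (x, 0, [::]) | x in [set x : X | `|x| <= 1]].
have B1 : B `<=` triple_bounded (1 : R).
  by move=> _ [x /= x1 <-]; split=> //=; rewrite ?normr0 ?big_nil.
have locA : affine_sup 3 (localizer 0 B).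
  rewrite (_ : 3 = 2 * 1 ^+ 2 + 1); last by ring.
  exact: localizer_affine_sup.
have loc0 f : dual f -> 0 <= localizer 0 B f := localizer_ge0 0 ler01 B1.
(* Symmetrized and weighted, [Psi k] adds [2 ^- (k + 3)] to the growth constant, less than 1/4 in
   total; the norm term adds [(3 + 3) / 24], again 1/4. *)
pose w (k : nat) : R := (2 ^+ (k + 4))^-1 / C k.
have w0 k : 0 < w k by rewrite divr_gt0// invr_gt0 exprn_gt0.
pose sym Phi f : R := Phi f + Phi (scl (-1) f).
have symA c Phi : affine_sup c Phi -> affine_sup (c + c) (sym Phi).
  by move=> cP; apply: affine_supD => //; exact: affine_sup_opp.
have sclK f : scl (-1) (scl (-1) f) = f.
  by apply/funext => x; rewrite /scl !mulN1r opprK.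
have sym_even Phi f : sym Phi (scl (-1) f) = sym Phi f.
  by rewrite /sym sclK addrC.
pose s (N : nat) f : R :=
  1 / 24 * sym (localizer 0 B) f + \sum_(k <- index_iota 0 N) w k * sym (Psi k) f.
have sA N : affine_sup (1 / 2) (s N).
  apply: (@affine_sup_weak _ _
    (1 / 24 * (3 + 3) + \sum_(k <- index_iota 0 N) w k * (C k + C k))).
    have -> : \sum_(k <- index_iota 0 N) w k * (C k + C k) =
              1 / 4 * (1 - (2 ^+ N)^-1).
      elim: N => [|N IH]; first by rewrite big_nil expr0 invr1 subrr mulr0.
      rewrite -{1}[N.+1]addn1 /index_iota subn0 iotaD big_cat /= big_seq1 add0n.
      move: IH; rewrite /index_iota subn0 => ->.
      rewrite /w exprD [in RHS]exprS; field.
      by rewrite !gt_eqF// exprn_gt0.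
    have : 0 < (2 ^+ N)^-1 :> R by rewrite invr_gt0 exprn_gt0.
    lra.
  apply: affine_supD; first by apply: affine_supZ; [lra|exact: symA].
  apply: affine_sup_sum => k; apply: affine_supZ; [exact: ltW|exact: symA].
have s_even N f : dual f -> s N (scl (-1) f) = s N f.
  move=> _; rewrite /s sym_even; congr (_ + _).
  by apply: eq_bigr => k _; rewrite sym_even.
have s_bounded f : dual f -> (forall N, s N f <= 1) -> forall x, `|f x| <= 5 * `|x|.
  move=> df /(_ 0); rewrite /s big_nil addr0 /sym => f24 x.
  have XN := @equivalent_norm_normr R X.
  apply: le_trans (dual_normP XN x df) (ler_wpM2r (normr_ge0 _) _).
  apply: dual_norm_le => // y y1.
  have H z : `|z| <= 1 -> f z <= 5.
    move=> z1; have := @localizer_ge _ _ 1 0 B (z, 0, [::]) f ler01 B1 df.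
    rewrite /spread big_nil mulr0 addr0 /height /= subr0.
    have Bz : ((0, 0, [::]) |` B) (z, 0, [::]) by right; exists z.
    move=> /(_ Bz) fz; have := loc0 _ (dual_scl (-1) df) => l0.
    have : f z <= Num.max 0 (f z) by rewrite le_max lexx orbT.
    (* The factor 1/24 turns [s 0 f <= 1] into this bound, and [24 < 5 ^+ 2]. *)
    have : Num.max 0 (f z) ^+ 2 <= 24 by lra.
    set u := Num.max _ _; nra.
  rewrite ler_norml H// andbT lerNl -(scalarN _ (proj1 df)).
  by apply: H; rewrite normrN.
have [p [pN p1 p2]] := sublevel_norm sA s_even (ler1n _ 5) s_bounded.
exists (dual_norm p); first by exists p.
have rot1 f g : dual f -> dual g -> dual_norm p f = 1 -> dual_norm p g = 1 ->
    dual_norm p (mid f g) = 1 -> f = g.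
  move=> df dg f1 g1 m1.
  have sf N : s N f <= 1 by apply: p1; rewrite ?f1.
  have sg N : s N g <= 1 by apply: p1; rewrite ?g1.
  apply: (sep _ _ df dg (s_bounded _ df sf) (s_bounded _ dg sg)) => k.
  have convex c Phi h h' : affine_sup c Phi -> dual h -> dual h' ->
      0 <= Phi h + Phi h' - 2 * Phi (mid h h').
    by move=> PhiA dh dh'; have := affine_sup_mid PhiA dh dh'; lra.
  have kfg := convex _ _ _ _ (PsiA k) df dg.
  apply/eqP; rewrite eq_le; apply/andP; split; last by lra.
  apply/ler_addgt0Pr => e e0.
  (* The total defect will be at most [2 - 2 * (1 - w k * e / 2)], which is [w k * e]. *)
  have we0 : 0 < w k * e / 2 by rewrite divr_gt0// mulr_gt0.
  have [N0 mN0] := p2 _ (dual_mid df dg) m1 _ we0.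
  (* The partial sum must contain index [k]; lengthening it does not lower its value, the terms
     being nonnegative. *)
  pose N := maxn N0 k.+1.
  have sym_ge0 i h : dual h -> 0 <= w i * sym (Psi i) h.
    by move=> dh; rewrite mulr_ge0 ?(ltW (w0 _))// addr_ge0// Psi0//; exact: dual_scl.
  have mN : s N0 (mid f g) <= s N (mid f g).
    rewrite lerD2l (big_cat_nat (n := N0) (p := N)) ?leq_maxl//= lerDl sumr_ge0// => i _.
    exact/sym_ge0/dual_mid.
  pose d i :=
    w i * sym (Psi i) f + w i * sym (Psi i) g - 2 * (w i * sym (Psi i) (mid f g)).
  have d0 i : 0 <= d i.
    apply: (convex (w i * (C i + C i)) (fun h => w i * sym (Psi i) h)) => //.
    by apply: affine_supZ; [exact: ltW|exact: symA].
  have dk : w k * (Psi k f + Psi k g - 2 * Psi k (mid f g)) <= d k.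
    have := convex _ _ _ _ (affine_sup_opp (PsiA k)) df dg.
    by move=> /(ler_wpM2l (ltW (w0 k))); rewrite mulr0 /d /sym; lra.
  have sumd : d k <= \sum_(i <- index_iota 0 N) d i.
    rewrite (big_cat_nat (n := k) (p := N)) ?leq0n//=; last by rewrite ltnW// leq_maxr.
    rewrite [X in _ + X]big_ltn ?leq_maxr// addrCA lerDl addr_ge0 ?sumr_ge0//.
  have locd := convex _ _ _ _ (symA _ _ locA) df dg.
  have := sf N; have := sg N.
  move: mN mN0; rewrite /s; move: sumd; rewrite /d sumrB -mulr_sumr big_split/= -/(d k).
  move=> H1 H2 H3 H4 H5.
  rewrite -(ler_pM2l (w0 k)); lra.
move=> u v df dg fg gm.
have [g0|g0] := eqVneq (dual_norm p v) 0.
  by rewrite (dual_norm_eq0 pN df) ?fg// (dual_norm_eq0 pN dg).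
pose c := (dual_norm p v)^-1.
have cE h : dual h -> dual_norm p h = dual_norm p v -> dual_norm p (scl c h) = 1.
  move=> dh hg; rewrite (dual_norm_scl pN _ dh) hg ger0_norm ?mulVf//.
  by rewrite invr_ge0; exact: (dual_norm_ge0 pN).
have : scl c u = scl c v.
  apply: rot1; rewrite ?cE//; try exact: dual_scl.
  rewrite -(cE (mid u v))//; last exact: dual_mid.
  by congr dual_norm; apply/funext => x; rewrite /mid /scl; field.
move=> /funeqP cfg; apply/funext => x.
by apply: (mulfI (invr_neq0 g0)); exact: cfg.
Qed.

End Renorming.

(** * Rotund renorming from countably many families of half-spaces *)

Section SliceFamilies.
Context {R : realType} {X : normedModType R}.
Implicit Types (f g h : {ptws X -> R}) (x y : X).

(** If every localizer had zero convexity defect at distinct [f] and [g], [localization] would give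
    a half-space of [H i] containing both, with distance at most [eta] on its list; the hypothesis
    excludes this. *)
Lemma rotund_of_localizers (I : countType) (H : I -> set (X * R * seq X)) :
  (forall f g, dual f -> dual g ->
    (forall x, `|f x| <= 5 * `|x|) -> (forall x, `|g x| <= 5 * `|x|) ->
    f <> g -> exists i eta, [/\ 0 < eta,
      exists2 t, H i t & t.1.2 < f t.1.1 \/ t.1.2 < g t.1.1 &
      forall t, H i t -> t.1.2 < f t.1.1 -> t.1.2 < g t.1.1 ->
        eta < \sum_(y <- t.2) (f y - g y) ^+ 2]) ->
  exists2 q : {ptws X -> R} -> R, equivalent_dual_norm q & rotund q.
Proof.
move=> sep.
(* Localizers are controlled on bounded families, so each [H i] is exhausted by integer bounds; the
   indices [(i, M, j)] remain countable. *)
pose HM i (M : nat) := H i `&` triple_bounded M%:R.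
have HMb i M : HM i M `<=` triple_bounded M%:R by move=> t [].
pose Psi k f : R := if (choice.unpickle k : option (I * nat * nat)) is Some (i, M, j)
  then localizer j (HM i M) f else 0.
(* The added 1 keeps [C k] positive for [M = 0]; numbers that code no index get the zero
   function. *)
pose C k : R := if (choice.unpickle k : option (I * nat * nat)) is Some (i, M, j)
  then 2 * M%:R ^+ 2 + M%:R + 1 else 1.
apply: (@rotund_renorming _ _ Psi C) => [k|k|k f df|f g df dg f5 g5 fg].
- rewrite /C; case: choice.unpickle => [[[i M] j]|//].
  by rewrite ltr_wpDl// addr_ge0// mulr_ge0// sqr_ge0.
- rewrite /C /Psi; case: choice.unpickle => [[[i M] j]|].
    apply: (affine_sup_weak _ (localizer_affine_sup j (ler0n R M) (@HMb i M))).
    by rewrite lerDl.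
  exact: affine_sup_weak affine_sup0.
- rewrite /Psi; case: choice.unpickle => [[[i M] j]|//].
  exact: localizer_ge0 (ler0n R M) (@HMb i M) df.
- apply: contrapT => /(sep f g df dg f5 g5)[i [eta [eta0 [t0 Ht0 ft0] sepi]]].
  have [M Mt] : exists M : nat, triple_bounded M%:R t0.
    exists (Num.bound (`|t0.1.1| + `|t0.1.2| + \sum_(y <- t0.2) `|y| ^+ 2)).
    have s0 : 0 <= \sum_(y <- t0.2) `|y| ^+ 2 :> R.
      by apply: sumr_ge0 => y _; exact: sqr_ge0.
    have := archi_boundP (addr_ge0 (addr_ge0 (normr_ge0 t0.1.1) (normr_ge0 t0.1.2)) s0).
    have := normr_ge0 t0.1.1; have := normr_ge0 t0.1.2.
    by set b := Num.bound _ => *; split; lra.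
  have [|t [Ht _] [ft gt]] := @localization _ _ _ (HM i M) f g eta t0
    (ler0n R M) (@HMb i M) df dg _ eta0 (conj Ht0 Mt) ft0.
    by move=> j; have := fg (choice.pickle (i, M, j)); rewrite /Psi choice.pickleK.
  by rewrite leNgt => /negP; apply; exact: sepi.
Qed.

End SliceFamilies.

(** * The weak* topology, and (i) implies (ii) *)

Section Topology.
Context {R : realType} {X : normedModType R}.
Implicit Types (f g h : {ptws X -> R}) (x y : X).

Lemma eval_continuous x : continuous (fun f : {ptws X -> R} => f x : R).
Proof. exact: (@proj_continuous X (fun=> R) x). Qed.

Lemma open_eval x (A : set R) : open A -> open [set f : {ptws X -> R} | A (f x)].
Proof.
move=> oA; apply: (@open_comp _ _ (fun f : {ptws X -> R} => f x : R) A) => //.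
by move=> f _; exact: eval_continuous.
Qed.

Lemma closed_eval x (A : set R) : closed A -> closed [set f : {ptws X -> R} | A (f x)].
Proof.
move=> cA; apply: (@closed_comp _ _ (fun f : {ptws X -> R} => f x : R) A) => //.
by move=> f _; exact: eval_continuous.
Qed.

Lemma set_val_continuous (A : set {ptws X -> R}) : continuous (set_val : A -> _).
Proof. exact: initial_continuous. Qed.

Lemma dual_ballP f : dual_ball X f <-> dual f /\ forall x, `|f x| <= `|x|.
Proof.
have XN := @equivalent_norm_normr R X.
split=> [[df f1]|[df f1]]; split=> //.
  move=> x; apply: le_trans (dual_normP XN x df) _.
  by rewrite -[leRHS]mul1r ler_wpM2r.
by apply: dual_norm_le => // x x1; exact: le_trans (f1 x) x1.
Qed.

(** The dual norm is weak* lower semicontinuous, so the pairs whose midpoint has norm above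
    [1 - n.+1%:R^-1] form an open set. In the intersection the midpoint has norm 1, and rotundity
    identifies the two points. *)
Lemma rotund_Gdelta_diagonal :
  (exists2 q : {ptws X -> R} -> R, equivalent_dual_norm q & rotund q) ->
  (exists2 q : {ptws X -> R} -> R, equivalent_dual_norm q &
          Gdelta_diagonal (dual_sphere q)).
Proof.
move=> [q [p pN qp] rotq]; exists q; first by exists p.
pose W n : set (dual_sphere q * dual_sphere q) :=
  \bigcup_(x in [set x | p x <= 1])
    [set u | 1 - n.+1%:R^-1 < mid (set_val u.1) (set_val u.2) x].
have SP (u : dual_sphere q) : dual (set_val u) /\ q (set_val u) = 1.
  by have [] := set_mem (svalP u).
exists W => [n|].
  apply: bigcup_open => x _.
  apply: (@open_comp _ _ (fun u : dual_sphere q * dual_sphere q =>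
     mid (set_val u.1) (set_val u.2) x : R) [set r | _ < r]); last exact: open_gt.
  move=> u _; rewrite /mid; apply: cvgM; last exact: cvg_cst.
  apply: cvgD.
    apply: (@continuous_comp _ _ _ (fun u => set_val u.1) (fun f => f x)).
      by apply: (@continuous_comp _ _ _ fst); [exact: cvg_fst|exact: set_val_continuous].
    exact: eval_continuous.
  apply: (@continuous_comp _ _ _ (fun u => set_val u.2) (fun f => f x)).
    by apply: (@continuous_comp _ _ _ snd); [exact: cvg_snd|exact: set_val_continuous].
  exact: eval_continuous.
apply/seteqP; split=> [[u v]|[u v]] /=; rewrite /diagonal/=.
  move=> <- n _; have [du qu] := SP u.
  have [x px fx] : exists2 x, p x <= 1 & 1 - n.+1%:R^-1 < set_val u x.
    apply: (dual_norm_gt pN du); rewrite -qp// qu ltrBlDr ltrDl invr_gt0//.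
  by exists x => //=; apply: lt_le_trans fx _; rewrite /mid; lra.
move=> Wuv; have [du qu] := SP u; have [dv qv] := SP v.
apply: val_inj; apply: (rotq _ _ du dv); first by rewrite [LHS]qu [RHS]qv.
rewrite [LHS]qv; have dm := dual_mid du dv.
rewrite -/(mid _ _) (qp _ dm); apply/eqP; rewrite eq_le; apply/andP; split.
  apply/ler_addgt0Pl => e e0; have [n ne] := ltr_add_invr e0.
  have [x /= px mx] := Wuv n I.
  have := le_trans (ler_norm _) (dual_norm_ge pN dm px).
  move: mx ne; set m := mid _ _ x; set N := dual_norm _ _; set c := _^-1; lra.
have := dual_norm_mid pN du dv; rewrite -!qp// [X in X + _]qu [X in _ + X]qv; lra.
Qed.

End Topology.

(** * (ii) implies (iii), and (iii) implies (iv) *)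

(** [rho u v] is the reciprocal of one plus the first index [n] at which the pair, in one of its two
    orders, is outside [W n]. If there is none it is 0, the value of [sup] on the empty set. *)
Lemma Gdelta_diagonal_symmetric (R : realType) (T : topologicalType) :
  Gdelta_diagonal T ->
  exists2 rho : T -> T -> R, symmetric_on rho &
    forall (x : T) (e : R), 0 < e ->
      exists2 D : set T, nbhs x D & (rho_diameter rho D < e%:E)%E.
Proof.
move=> [W Wo WE].
pose far u v : set nat := [set n | ~ W n (u, v) \/ ~ W n (v, u)].
pose rho u v : R := sup [set n.+1%:R^-1 | n in far u v].
have inv_le1 n : n.+1%:R^-1 <= 1 :> R by rewrite invf_le1// ler1n.
have far_sup u v n : far u v n -> n.+1%:R^-1 <= rho u v.
  by move=> fn; apply: ub_le_sup; [exists 1 => _ [k _ <-]|exists n].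
have diagW u n : W n (u, u).
  have : diagonal (u, u) by [].
  by rewrite WE; apply.
have rho_le u v e : 0 <= e -> (forall n, far u v n -> n.+1%:R^-1 <= e) -> rho u v <= e.
  move=> e0 fe; have [[n fn]|/set0P/negP/negPn/eqP far0] := pselect (far u v !=set0).
    by apply: ge_sup; [exists n.+1%:R^-1, n|move=> _ [k fk <-]; exact: fe].
  by rewrite /rho far0 image_set0 sup0.
have rho_ge0 u v : 0 <= rho u v.
  have [[n fn]|/set0P/negP/negPn/eqP far0] := pselect (far u v !=set0).
    by apply: le_trans (far_sup _ _ _ fn); rewrite invr_ge0.
  by rewrite /rho far0 image_set0 sup0.
exists rho.
  split=> // [u v|u v].
    rewrite /rho; congr (sup (image _ _)); apply/seteqP.
    by split=> n [] ?; by [left|right].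
  split=> [uv0|<-]; last first.
    by apply/eqP; rewrite eq_le rho_ge0 andbT; apply: rho_le => // n [|] /(_ (diagW u n)).
  apply: contrapT => uv; suff [n fn] : far u v !=set0.
    by have := far_sup _ _ _ fn; rewrite uv0 leNgt invr_gt0 ltr0n.
  apply: contrapT => far0; apply: uv.
  suff : diagonal (u, v) by [].
  rewrite WE => n _; apply: contrapT => Wn; apply: far0; exists n; by left.
move=> x e e0; have [N] := ltr_add_invr e0; rewrite add0r => Ne.
have WD n : exists2 D, nbhs x D & D `*` D `<=` W n.
  have : nbhs (x, x) (W n) by apply: open_nbhs_nbhs; split.
  move=> [[A B] /= [xA xB] AB]; exists (A `&` B); first exact: filterI.
  by move=> [u v] /= [[Au _] [_ Bv]]; apply: AB.
have /choice [D DP] : forall n, exists D, nbhs x D /\ D `*` D `<=` W n.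
  by move=> n; have [D] := WD n; exists D.
(* Two points of this finite intersection lie in [W n] in both orders for all [n <= N], so [rho] is
   at most [N.+1%:R^-1] there. *)
exists [set u | forall n, (n < N.+1)%N -> D n u].
  elim: N.+1 => [|k IH]; first by apply: filterS filterT.
  have [xDk _] := DP k; apply: filterS2 IH xDk => u uk Dku n.
  by rewrite ltnS leq_eqVlt => /predU1P[->|/uk].
apply: (@le_lt_trans _ _ (N.+1%:R^-1)%:E); last by rewrite lte_fin.
apply: ge_ereal_sup => _ [u Du [v Dv <-]]; rewrite lee_fin; apply: rho_le => [|n fn].
  by rewrite invr_ge0.
have Nn : (N < n)%N.
  rewrite ltnNge; apply/negP => nN.
  by case: fn => -[]; apply: (proj2 (DP n)); split=> /=;
    [exact: Du|exact: Dv|exact: Dv|exact: Du].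
by rewrite lef_pV2 ?posrE// ler_nat ltnW.
Qed.

Lemma pair_subset1 (T : Type) (x y : T) (A : set T) :
  (A x -> A y -> x = y) -> is_subset1 ([set x; y] `&` A).
Proof.
move=> xy u v [[->|->] Au] [[->|->] Av] //; first exact: xy.
by apply/esym/xy.
Qed.

(** Open sets of diameter below [n.+1%:R^-1] form the covers: distinct points share none of them
    once this bound is below [rho x y]. *)
Lemma symmetric_star (R : realType) (T : topologicalType) (rho : T -> T -> R) :
  symmetric_on rho ->
  (forall (x : T) (e : R), 0 < e ->
      exists2 D : set T, nbhs x D & (rho_diameter rho D < e%:E)%E) ->
  exists2 U : (set (set T))^nat, star_sequence U &
    forall n, \bigcup_(V in U n) V = [set: T].
Proof.
move=> [rho0 _ rhoE] small.
pose U n : set (set T) := [set V | open V /\ (rho_diameter rho V < (n.+1%:R^-1)%:E)%E].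
have Ucov n : \bigcup_(V in U n) V = [set: T].
  apply/seteqP; split=> // x _.
  have [|D xD De] := small x n.+1%:R^-1; first by rewrite invr_gt0.
  exists D^°; last exact: nbhs_singleton (nbhs_interior xD).
  split; first exact: open_interior.
  apply: le_lt_trans De; apply: le_ereal_sup => _ [u Du [v Dv <-]].
  by exists u; [exact: interior_subset|exists v => //; exact: interior_subset].
exists U => //; split=> [n V []//|x y].
have star n : (forall V, U n V -> V x -> V y -> x = y) ->
    ([set x; y] `&` \bigcup_(V in U n) V) !=set0 /\
    (forall V, U n V -> is_subset1 ([set x; y] `&` V)).
  move=> xy; split; first by exists x; rewrite Ucov; split=> //; left.
  by move=> V UV; apply: pair_subset1; exact: xy.
have [xy|xy] := pselect (x = y); first by exists 0%N; apply: star.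
have xy0 : 0 < rho x y.
  by rewrite lt_def rho0 andbT; apply/eqP => /rhoE.
have [n] := ltr_add_invr xy0; rewrite add0r => nxy.
exists n; apply: star => V [_ Vn] Vx Vy; exfalso.
have : ((rho x y)%:E <= rho_diameter rho V)%E.
  by apply: ereal_sup_ubound; exists x => //; exists y.
by move=> /le_lt_trans /(_ Vn); rewrite lte_fin ltNge ltW.
Qed.

(** * Slices of the dual ball: (i) implies (v), and (v) implies (i) *)

Section SlicesOfTheBall.
Context {R : realType} {X : normedModType R}.
Implicit Types (f g h : {ptws X -> R}) (x y : X).

(** For distinct [f] and [g], rotundity gives a rational [r] between the norm of the midpoint and
    one of the two norms. Some slice at level [r] by a unit ball vector contains [f] or [g]; none
    contains both, since the midpoint would then exceed [r] as well. *)
Lemma rotund_star_slices : (exists x : X, x != 0) ->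
  (exists2 q : {ptws X -> R} -> R, equivalent_dual_norm q & rotund q) ->
  exists2 U : (set (set (dual_ball X)))^nat, star_sequence U &
    forall n V, U n V -> slice V.
Proof.
move=> [x0 x0_neq0] [q [p pN qp] rotq].
pose S x (a : R) := [set f : dual_ball X | a < (set_val f : X -> R) x].
pose U n : set (set (dual_ball X)) := if (choice.unpickle n : option rat) is Some r then
  [set S x (ratr r) | x in [set x | x != 0 /\ p x <= 1]] else set0.
have Uslice n V : U n V -> slice V.
  rewrite /U; case: choice.unpickle => // r [x [x0' _] <-]; exists x => //.
  by exists (ratr r).
have Uopen n V : U n V -> open V.
  move=> /Uslice [x _ [a ->]].
  apply: (@open_comp _ _ (set_val : dual_ball X -> _)
    [set f : {ptws X -> R} | a < f x]).
    by move=> f _; exact: set_val_continuous.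
  exact: (@open_eval _ _ x _ (@open_gt _ a)).
exists U => //; split=> // f g.
have dualP (u : dual_ball X) : dual (set_val u) by have [] := set_mem (svalP u).
have df := dualP f; have dg := dualP g.
suff [r [h [x [fgh x_neq0 px hx]]] rfg] : exists2 r : rat,
    exists (h : dual_ball X) x, [/\ [set f; g] h, x != 0, p x <= 1 &
        ratr r < (set_val h : X -> R) x] &
    f = g \/ q (mid (set_val f) (set_val g)) < ratr r.
  exists (choice.pickle r); rewrite /U choice.pickleK; split.
    by exists h; split=> //; exists (S x (ratr r)) => //; exists x.
  move=> _ [y [y0 py] <-]; apply: pair_subset1 => fy gy.
  case: rfg => // qr; exfalso; have dm := dual_mid df dg.
  have := le_trans (ler_norm _) (dual_norm_ge pN dm py).
  rewrite -qp// {1}/mid; move: fy gy; rewrite /S /=; lra.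
have [fg|fg] := pselect (f = g).
  (* For a repeated point only coverage matters: [f] exceeds -1 at [y] or at [- y]. *)
  exists (-1); last by left.
  have px0 : 0 < p x0.
    rewrite lt_def norm_ge0// andbT; apply: contra x0_neq0 => /eqP/(norm_eq0 pN) ->.
    by [].
  pose y := (p x0)^-1 *: x0.
  have y0 : y != 0 by rewrite scaler_eq0 negb_or invr_neq0 ?gt_eqF.
  have pZ (a : R) x : p (a *: x) = `|a| * p x by case: pN => -[_ + _] _; apply.
  have py : p y = 1 by rewrite pZ ger0_norm ?mulVf ?invr_ge0 ?gt_eqF// ltW.
  have pNy : p (- y) = 1 by rewrite -scaleN1r pZ normrN1 mul1r.
  have [fy|fy] := leP 0 ((set_val f : X -> R) y).
    exists f, y; split=> //; [by left|by rewrite py|].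
    by rewrite rmorphN1; apply: lt_le_trans fy; rewrite oppr_lt0.
  exists f, (- y); split=> //; [by left|by rewrite oppr_eq0|by rewrite pNy|].
  rewrite rmorphN1 (scalarN _ (proj1 df)); apply: (@lt_trans _ _ 0); lra.
have dm := dual_mid df dg.
have q_lt (h : dual_ball X) : dual (set_val h) -> [set f; g] h ->
    q (mid (set_val f) (set_val g)) < q (set_val h) ->
    exists2 r : rat,
    exists (h : dual_ball X) x, [/\ [set f; g] h, x != 0, p x <= 1 &
        ratr r < (set_val h : X -> R) x] &
    f = g \/ q (mid (set_val f) (set_val g)) < ratr r.
  move=> dh fgh /rat_in_itvoo[r]; rewrite in_itv/= => /andP[mr rh].
  exists r; last by right.
  rewrite qp// in rh; have [x px rx] := dual_norm_gt pN dh rh.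
  (* The level [r] exceeds a norm, so it is positive and [x] cannot be 0. *)
  exists h, x; split=> //; apply/eqP => xE; move: rx.
  rewrite xE (scalar0 (proj1 dh)) ltNge => /negP; apply.
  by apply: le_trans (ltW mr); rewrite qp// dual_norm_ge0.
have [fm|fm] := ltP (q (mid (set_val f) (set_val g))) (q (set_val f)).
  by apply: q_lt fm => //; left.
have [gm|gm] := ltP (q (mid (set_val f) (set_val g))) (q (set_val g)).
  by apply: q_lt gm => //; right.
(* Neither norm exceeds that of the midpoint, so all three agree. *)
exfalso; apply: fg; apply: val_inj.
have := dual_norm_mid pN df dg; rewrite -!qp//= => fgm.
have qfg : q (set_val f) = q (set_val g) by lra.
apply: (rotq _ _ df dg qfg).
rewrite -[RHS]/(q (mid (set_val f) (set_val g))); lra.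
Qed.

(** Division by 5 carries the functionals to be separated into the dual ball. With empty lists the
    distance sum is 0, so no half-space of the chosen family may contain both, which is the second
    clause of the star property. *)
Lemma star_slices_rotund :
  (exists2 U : (set (set (dual_ball X)))^nat, star_sequence U &
    forall n V, U n V -> slice V) ->
  exists2 q : {ptws X -> R} -> R, equivalent_dual_norm q & rotund q.
Proof.
move=> [U [_ Ustar] Uslice].
(* Testing at [5 *: t.1.1] undoes the division by 5. *)
pose H n : set (X * R * seq X) := [set t | t.2 = [::] /\
  U n [set h : dual_ball X | t.1.2 < (set_val h : X -> R) (5 *: t.1.1)]].
apply: (rotund_of_localizers (H := H)) => f g df dg f5 g5 fg.
have ball h : dual h -> (forall x, `|h x| <= 5 * `|x|) -> dual_ball X (scl 5^-1 h).
  move=> dh h5; apply/dual_ballP; split; first exact: dual_scl.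
  move=> x; rewrite /scl normrM ger0_norm ?invr_ge0//.
  by rewrite ler_pdivrMl.
pose f' : dual_ball X := SigSub (mem_set (ball f df f5)).
pose g' : dual_ball X := SigSub (mem_set (ball g dg g5)).
have scl5 h : dual h -> forall x, (scl 5^-1 h : X -> R) (5 *: x) = h x.
  by move=> dh x; rewrite /scl (scalarZ _ _ (proj1 dh)) mulKf.
have fg' : f' <> g'.
  move=> fgE; apply: fg; apply/funext => x.
  rewrite -(scl5 f df x) -(scl5 g dg x).
  exact: (congr1 (fun u : dual_ball X => (set_val u : X -> R) (5 *: x)) fgE).
have [n [[h [fgh [V UV Vh]]] Un]] := Ustar f' g'.
have [x _ [a VE]] := Uslice _ _ UV.
exists n, 1; split=> //.
  exists (5^-1 *: x, a, [::]).
    split=> //=; move: UV; rewrite VE; congr (U n _).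
    by apply/funext => k; rewrite scalerA mulfV// scale1r.
  move: Vh; rewrite VE /=; case: fgh => -> /=.
    by rewrite (scalarZ _ _ (proj1 df)) => ?; left.
  by rewrite (scalarZ _ _ (proj1 dg)) => ?; right.
move=> t [_ /Un] fgt ft gt; exfalso; apply: fg'; apply: fgt; split=> /=.
- by left.
- by rewrite -(scl5 f df) in ft; exact: ft.
- by right.
- by rewrite -(scl5 g dg) in gt; exact: gt.
Qed.

End SlicesOfTheBall.

(** * Compactness and covers of the sphere: (iv) implies (i) *)

Lemma compact_cover_compact (T : topologicalType) (A : set T) :
  compact A -> cover_compact A.
Proof.
have [->|/set0P[a _]] := eqVneq A set0.
  by move=> _ I D f _ _; exists fset0.
pose Tp : ptopologicalType :=
  HB.pack (T : Type) (Topological.class T) (isPointed.Build T a).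
move=> cA; have cAp : @compact Tp A by exact: cA.
by rewrite compact_cover in cAp; exact: cAp.
Qed.

Section SphereCovers.
Context {R : realType} {X : normedModType R}.
Implicit Types (f g h : {ptws X -> R}) (x y : X).

(** The dual unit ball of [p], written by pointwise conditions that are visibly closed in the
    product topology. *)
Definition polar_ball (p : X -> R) : set {ptws X -> R} :=
  [set f | scalar (f : X -> R) /\ forall x, `|f x| <= p x].

Lemma polar_ball_closed (p : X -> R) : closed (polar_ball p).
Proof.
have -> : polar_ball p = (\bigcap_(u in [set: R * X * X])
     [set f | f (u.1.1 *: u.1.2 + u.2) - (u.1.1 * f u.1.2 + f u.2) = 0]) `&`
  \bigcap_(x in [set: X]) ([set f : {ptws X -> R} | f x <= p x] `&`
    [set f : {ptws X -> R} | - p x <= f x]).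
  apply/seteqP; split=> [f [sf fp]|f [sf fp]]; split.
  - by move=> [[a x] y] _ /=; rewrite sf subrr.
  - by move=> x _; have := fp x; rewrite ler_norml => /andP[].
  - move=> a x y; apply/eqP; rewrite -subr_eq0; apply/eqP.
    exact: (sf (a, x, y) I).
  - by move=> x; have [] := fp x I; rewrite ler_norml /= => -> ->.
apply: closedI; apply: closed_bigI.
  move=> [[a x] y] _ /=.
  apply: (@closed_comp _ _ (fun f : {ptws X -> R} =>
    f (a *: x + y) - (a * f x + f y) : R) [set r | r = 0]).
    move=> f _.
    pose ev z (f : {ptws X -> R}) : R := f z.
    have evc z : {for f, continuous (ev z)} by exact: eval_continuous.
    apply: (@continuousB _ _ _ (ev (a *: x + y)) (fun f => a * ev x f + ev y f)) => //.
    apply: (@continuousD _ _ _ (fun f => a * ev x f) (ev y)) => //.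
    exact: (@continuousM _ _ (cst a) (ev x) _ (@cst_continuous _ _ _ _)).
  exact: closed_eq.
move=> x _; apply: closedI.
  exact: (@closed_eval _ _ x _ (@closed_le _ (p x))).
exact: (@closed_eval _ _ x _ (@closed_ge _ (- p x))).
Qed.

(** Banach-Alaoglu: the ball is closed in a product of segments. *)
Lemma polar_ball_compact (p : X -> R) : compact (polar_ball p).
Proof.
have box := @tychonoff X (fun=> R) _ (fun x => segment_compact (a := - p x) (b := p x)).
apply: subclosed_compact (@polar_ball_closed p) box _ => f [_ fp] x /=.
by rewrite in_itv/= -ler_norml.
Qed.


Section Sphere.
Context (p : X -> R) (pN : equivalent_norm p).

Lemma polar_ball_dual f : polar_ball p f -> dual f.
Proof.
case: pN => _ [c [C [c0 C0 pC]]] [sf fp].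
apply: (bounded_dual sf) => x; apply: le_trans (fp x) _.
by have [_] := pC x; exact.
Qed.

Lemma polar_ballP f : dual f -> dual_norm p f <= 1 -> polar_ball p f.
Proof.
move=> df f1; split=> [|x]; first by case: df.
by apply: le_trans (dual_normP pN x df) _; rewrite -[leRHS]mul1r ler_wpM2r// norm_ge0.
Qed.

Lemma polar_ball_norm f : polar_ball p f -> dual_norm p f <= 1.
Proof.
by move=> [_ fp]; apply: (dual_norm_le pN) => // x; exact/le_trans/fp.
Qed.

(** Norms on [C] may approach 1, so one vector nearly norming [f] need not suffice. For the sums
    [y N] the deficit [N - f (y N)] stays below 1, while [N - c (y N)] is at least
    [N * (1 - dual_norm p c)]; compactness makes [N] uniform over [C]. *)
Lemma slice_avoiding (C : set {ptws X -> R}) f :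
  compact C -> (forall c, C c -> dual c /\ dual_norm p c < 1) ->
  dual f -> dual_norm p f = 1 ->
  exists x a, [/\ 0 <= a, a < f x & forall c, C c -> c x < a].
Proof.
move=> Cc Cd df f1.
have /choice[u uP] : forall k : nat, exists x, p x <= 1 /\ 1 - (2 ^+ k.+1)^-1 < f x.
  move=> k; have [|x px fx] := @dual_norm_gt _ _ _ pN f (1 - (2 ^+ k.+1)^-1) df.
    by rewrite f1 ltrBlDr ltrDl invr_gt0 exprn_gt0.
  by exists x.
pose y N := \sum_(k < N) u k.
have yS N : y N.+1 = y N + u N by rewrite /y big_ord_recr.
have fy N : N%:R - 1 < f (y N).
  (* The first [N] deficits add up to at most [1 - 2 ^- N]. *)
  have H : N%:R - 1 + (2 ^+ N)^-1 <= f (y N).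
    elim: N => [|N IH].
      by rewrite /y big_ord0 (scalar0 (proj1 df)) expr0 invr1 addrNK.
    rewrite yS (scalarD _ _ (proj1 df)) -natr1.
    have E : (2 ^+ N)^-1 = 2 * (2 ^+ N.+1)^-1 :> R.
      by rewrite exprS; field; rewrite gt_eqF// exprn_gt0.
    by move: IH; rewrite E; have [_] := uP N; set b := (2 ^+ N.+1)^-1; lra.
  by apply: lt_le_trans H; rewrite ltrDl invr_gt0 exprn_gt0.
have uc c k : C c -> c (u k) <= dual_norm p c.
  move=> /Cd[dc _]; apply: le_trans (ler_norm _) _.
  by apply: (dual_norm_ge pN dc); case: (uP k).
have cov : C `<=` cover [set: nat] (fun N => [set c | c (y N.+1) < N%:R]).
  move=> c Cc'; have [dc c1] := Cd _ Cc'.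
  have /ltr_add_invr[N Nd] : 0 < 1 - dual_norm p c by rewrite subr_gt0.
  exists N => //=.
  have cy M : c (y M) <= M%:R * dual_norm p c.
    elim: M => [|M IH]; first by rewrite /y big_ord0 (scalar0 (proj1 dc)) mul0r.
    rewrite yS (scalarD _ _ (proj1 dc)) -natr1 mulrDl mul1r.
    by apply: lerD IH _; exact: uc.
  apply: le_lt_trans (cy _) _.
  have : 1 < (1 - dual_norm p c) * N.+1%:R.
    by rewrite -ltr_pdivrMr// div1r; move: Nd; rewrite add0r.
  by rewrite -natr1; lra.
have [] := compact_cover_compact Cc _ cov.
  by move=> N _; exact: (@open_eval _ _ (y N.+1) _ (@open_lt _ N%:R)).
move=> D _ DC; pose M := \max_(i <- D) i.
exists (y M.+1), M%:R; split=> //.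
  by have := fy M.+1; rewrite -natr1 addrK.
move=> c Cc'; have [N DN /= cN] := DC c Cc'.
have NM : (N <= M)%N by apply: (leq_bigmax_seq (F := id)).
have [dc c1] := Cd _ Cc'.
(* On [C] the sets of the cover increase with the index, since [c (u k) <= 1]; hence the largest
   index serves for all. *)
elim: M NM => [|M IH]; first by rewrite leqn0 => /eqP <-.
rewrite leq_eqVlt => /predU1P[<- //|/IH cM].
rewrite yS (scalarD _ _ (proj1 dc)) -natr1 ltr_leD//.
by apply: le_trans (uc _ _ Cc') (ltW c1).
Qed.

End Sphere.

(** The pairs of [K] sharing no member of [O] form a compact set off the diagonal. Each of them
    differs at some vector, and finitely many vectors detect them all. *)
Lemma finite_separation (K : set {ptws X -> R}) (O : set (set {ptws X -> R})) :
  compact K -> (forall f, K f -> scalar (f : X -> R)) ->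
  (forall V, O V -> open V) -> K `<=` \bigcup_(V in O) V ->
  exists ys : seq X, forall f g, K f -> K g ->
    \sum_(y <- ys) (f y - g y) ^+ 2 <= 1 -> exists2 V, O V & V f /\ V g.
Proof.
move=> Kc Ks Oo KO.
pose near : set ({ptws X -> R} * {ptws X -> R}) := \bigcup_(V in O) (V `*` V).
have near_open : open near.
  apply: bigcup_open => V /Oo Vo.
  have -> : V `*` V = (fst @^-1` V) `&` (snd @^-1` V) by [].
  apply: openI; apply: open_comp => // u _; [exact: cvg_fst|exact: cvg_snd].
have Pc : compact ((K `*` K) `&` ~` near).
  by apply: compact_closedI; [exact: compact_setX|exact: open_closedC].
have cov : (K `*` K) `&` ~` near `<=` cover [set: X]
    (fun y => [set u : {ptws X -> R} * {ptws X -> R} | 1 < (u.1 y - u.2 y) ^+ 2]).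
  move=> [f g] [[/= Kf Kg] fg].
  have [x fgx] : exists x, f x <> g x.
    apply/existsNP => E; have fgE : f = g by apply/funext.
    by apply: fg; have [V OV Vf] := KO _ Kf; exists V => //; split=> //=; rewrite -fgE.
  have fgx0 : f x - g x != 0 by rewrite subr_eq0; apply/eqP.
  (* After rescaling the two values differ by 2, so the square exceeds 1. *)
  exists ((2 / (f x - g x)) *: x) => //=.
  rewrite (scalarZ _ _ (Ks _ Kf)) (scalarZ _ _ (Ks _ Kg)) -mulrBr mulfVK//.
  by rewrite -natrX ltr1n.
have [] := compact_cover_compact Pc _ cov.
  move=> y _.
  apply: (@open_comp _ _ (fun u : {ptws X -> R} * {ptws X -> R} =>
    (u.1 y - u.2 y) ^+ 2 : R) [set r | 1 < r]); last exact: open_gt.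
  move=> u _; pose d (u : {ptws X -> R} * {ptws X -> R}) : R := u.1 y - u.2 y.
  have dc : {for u, continuous d}.
    apply: (@continuousB _ _ _
      (fun u : {ptws X -> R} * {ptws X -> R} => u.1 y : R) (fun u => u.2 y)).
      apply: (@continuous_comp _ _ _ fst (fun f : {ptws X -> R} => f y : R));
        first exact: cvg_fst.
      exact: eval_continuous.
    apply: (@continuous_comp _ _ _ snd (fun f : {ptws X -> R} => f y : R));
      first exact: cvg_snd.
    exact: eval_continuous.
  exact: (@continuousM _ _ d d).
move=> D _ DP; exists D => f g Kf Kg fg.
have [[V OV [/= Vf Vg]]|fg_far] := pselect (near (f, g)); first by exists V.
have [y Dy /= fgy] := DP (f, g) (conj (conj Kf Kg) fg_far).
exfalso; move: fg; rewrite leNgt => /negP; apply; apply: lt_le_trans fgy _.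
rewrite (big_rem y)//= lerDl sumr_ge0// => z _; exact: sqr_ge0.
Qed.

(** The [inr] families separate functionals of different norms. For a common norm [r], the [inl]
    families use the slices obtained on the unit sphere, with levels multiplied by a rational close
    to [r] so that the index stays countable. *)
Lemma star_cover_rotund :
  (exists2 q : {ptws X -> R} -> R, equivalent_dual_norm q &
     exists2 U : (set (set (dual_sphere q)))^nat, star_sequence U &
       forall n, \bigcup_(V in U n) V = [set: dual_sphere q]) ->
  exists2 q : {ptws X -> R} -> R, equivalent_dual_norm q & rotund q.
Proof.
move=> [q [p pN qp] [U [Uo Ustar] Ucov]].
pose O n : set (set {ptws X -> R}) :=
  [set V | open V /\ U n ((set_val : dual_sphere q -> _) @^-1` V)].
have Oo n V : O n V -> open V by case.
have Ocov n f : dual f -> dual_norm p f = 1 -> (\bigcup_(V in O n) V) f.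
  move=> df f1; have Sf : dual_sphere q f by split=> //=; rewrite qp.
  pose f' : dual_sphere q := SigSub (mem_set Sf).
  have : [set: dual_sphere q] f' by [].
  rewrite -(Ucov n) => -[V UV Vf]; have [W Wo WV] := Uo _ _ UV.
  exists W; first by split=> //; rewrite WV.
  by move: Vf; rewrite -WV.
have Osep f g : dual f -> dual g -> dual_norm p f = 1 -> dual_norm p g = 1 ->
    f <> g -> exists n, forall V, O n V -> V f -> V g -> False.
  move=> df dg f1 g1 fg.
  have Sf : dual_sphere q f by split=> //=; rewrite qp.
  have Sg : dual_sphere q g by split=> //=; rewrite qp.
  have [n [_ Un]] := Ustar (SigSub (mem_set Sf)) (SigSub (mem_set Sg)).
  exists n => V [_ /Un V1] Vf Vg; apply: fg.
  by have /(congr1 set_val) := V1 (SigSub (mem_set Sf)) (SigSub (mem_set Sg))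
    (conj (or_introl erefl) Vf) (conj (or_intror erefl) Vg).
pose small n (x : X) (a : R) (ys : seq X) := forall f g,
  polar_ball p f -> polar_ball p g -> a <= f x -> a <= g x ->
  \sum_(y <- ys) (f y - g y) ^+ 2 <= 1 -> exists2 V, O n V & V f /\ V g.
have smallP n f : dual f -> dual_norm p f = 1 ->
    exists x a ys, [/\ 0 <= a, a < f x & small n x a ys].
  move=> df f1.
  (* [C] misses the sphere, which [O n] covers, so its points have norm below 1. *)
  pose C := polar_ball p `&` ~` \bigcup_(V in O n) V.
  have Cc : compact C.
    apply: compact_closedI; first exact: polar_ball_compact.
    by apply: open_closedC; apply: bigcup_open => V /Oo.
  have Cd c : C c -> dual c /\ dual_norm p c < 1.
    move=> [Bc Oc]; have dc := polar_ball_dual pN Bc; split=> //.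
    rewrite lt_neqAle (polar_ball_norm pN Bc) andbT; apply/eqP => c1.
    exact/Oc/Ocov.
  have [x [a [a0 afx Cx]]] := slice_avoiding pN Cc Cd df f1.
  have Kc : compact (polar_ball p `&` [set h : {ptws X -> R} | a <= h x]).
    apply: compact_closedI; first exact: polar_ball_compact.
    exact: (@closed_eval _ _ x _ (@closed_ge _ a)).
  have [||ys ysP] := finite_separation Kc _ (Oo n).
  - by move=> h [[]].
  - move=> h [Bh ahx]; apply: contrapT => Oh.
    by have := Cx h (conj Bh Oh); rewrite ltNge ahx.
  by exists x, a, ys; split=> // g h Bg Bh ag ah; exact: ysP.
pose H (i : nat * rat + rat) : set (X * R * seq X) := match i with
  | inl (n, rho) => [set t |
      exists2 a, t.1.2 = ratr rho * a & 0 <= a /\ small n t.1.1 a t.2]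
  | inr rho => [set (x, ratr rho, [::]) | x in [set x | p x <= 1]]
  end.
apply: (rotund_of_localizers (H := H)) => f g df dg _ _ fg.
have norm_lt h k : dual h -> dual k -> dual_norm p h < dual_norm p k ->
    exists i, (exists2 t, H i t & t.1.2 < k t.1.1) /\
    forall t, H i t -> t.1.2 < h t.1.1 -> False.
  move=> dh dk /rat_in_itvoo[r]; rewrite in_itv/= => /andP[hr rk].
  exists (inr r); split.
    by have [x px rx] := dual_norm_gt pN dk rk; exists (x, ratr r, [::]) => //; exists x.
  move=> _ [x px <-] /= rx; have := le_trans (ler_norm _) (dual_norm_ge pN dh px).
  by rewrite leNgt (lt_trans hr).
have [fg_lt|gf_lt|fgE] := ltgtP (dual_norm p f) (dual_norm p g).
- have [i [[t Ht gt] Hi]] := norm_lt _ _ df dg fg_lt.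
  exists i, 1; split=> //; first by exists t => //; right.
  by move=> u Hu fu; case: (Hi _ Hu fu).
- have [i [[t Ht ft] Hi]] := norm_lt _ _ dg df gf_lt.
  exists i, 1; split=> //; first by exists t => //; left.
  by move=> u Hu _ gu; case: (Hi _ Hu gu).
have := dual_norm_ge0 pN df; rewrite le_eqVlt => /predU1P[/esym f0|r0].
  by case: fg; rewrite (dual_norm_eq0 pN df f0) (dual_norm_eq0 pN dg)// -fgE.
set r := dual_norm p f in fgE r0.
have dscl h : dual h -> dual (scl r^-1 h) := @dual_scl _ _ r^-1 h.
have nscl h : dual h -> dual_norm p h = r -> dual_norm p (scl r^-1 h) = 1.
  by move=> dh hr; rewrite (dual_norm_scl pN _ dh) hr gtr0_norm ?invr_gt0// mulVf ?gt_eqF.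
have f1 := nscl f df erefl; have g1 := nscl g dg (esym fgE).
have fg' : scl r^-1 f <> scl r^-1 g.
  move=> /funeqP E; apply: fg; apply/funext => x; apply: (mulfI (invr_neq0 _)) (E x).
  by rewrite gt_eqF.
have [n On] := Osep _ _ (dscl f df) (dscl g dg) f1 g1 fg'.
have [x [a [ys [a0 afx sm]]]] := smallP n _ (dscl f df) f1.
(* [rho] lies above [r] for the sake of [slice_le]; dividing by [a + 1] stays meaningful when
   [a = 0]. *)
have [rho r_rho rho_f] : exists2 rho : rat, r < ratr rho & ratr rho * a < f x.
  have rafx : 0 < f x - r * a.
    by move: afx; rewrite /scl mulrC ltr_pdivlMr// subr_gt0 mulrC.
  have a1 : 0 < a + 1 by lra.
  have /rat_in_itvoo[rho] : r < r + (f x - r * a) / (a + 1) by rewrite ltrDl divr_gt0.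
  rewrite in_itv/= => /andP[r_rho]; rewrite -ltrBlDl ltr_pdivlMr// => rho_f.
  by exists rho => //; lra.
(* [r ^+ 2] becomes the bound 1 of [small] after division of the functionals by [r]. *)
exists (inl (n, rho)), (r ^+ 2); split; first by rewrite exprn_gt0.
  by exists (x, ratr rho * a, ys); [exists a|left].
move=> [[y b] zs] [a' /= -> [a'0 sm']] fy gy; rewrite ltNge; apply/negP => fgz.
(* From [r < ratr rho] and [0 <= a'] follows [r * a' <= ratr rho * a']. *)
have slice_le h : ratr rho * a' < h y -> a' <= scl r^-1 h y.
  move=> hy; rewrite /scl mulrC ler_pdivlMr//; apply: ltW; apply: le_lt_trans hy.
  by rewrite mulrC ler_wpM2r// ltW.
have [|||||V OV [Vf Vg]] := sm' (scl r^-1 f) (scl r^-1 g).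
- by apply: polar_ballP => //; [exact: dscl|rewrite f1].
- by apply: polar_ballP => //; [exact: dscl|rewrite g1].
- exact: slice_le.
- exact: slice_le.
- rewrite /scl; under eq_bigr do rewrite -mulrBr exprMn.
  rewrite -mulr_sumr exprVn mulrC ler_pdivrMr ?mul1r// exprn_gt0//.
exact: On OV Vf Vg.
Qed.

End SphereCovers.

Theorem theorem1p6 (R : realType) (X : completeNormedModType R)
    (X_neq0 : exists x : X, x != 0) :
  [<-> (exists2 q : {ptws X -> R} -> R, equivalent_dual_norm q & rotund q);
       (exists2 q : {ptws X -> R} -> R, equivalent_dual_norm q &
          Gdelta_diagonal (dual_sphere q));
       (exists2 q : {ptws X -> R} -> R, equivalent_dual_norm q &
          exists2 rho : dual_sphere q -> dual_sphere q -> R,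
            symmetric_on rho &
            forall (f : dual_sphere q) (e : R), 0 < e ->
              exists2 D : set (dual_sphere q), nbhs f D &
                (rho_diameter rho D < e%:E)%E);
       (exists2 q : {ptws X -> R} -> R, equivalent_dual_norm q &
          exists2 U : (set (set (dual_sphere q)))^nat, star_sequence U &
            forall n, \bigcup_(V in U n) V = [set: dual_sphere q]);
       (exists2 U : (set (set (dual_ball X)))^nat, star_sequence U &
          forall n V, U n V -> slice V)].
Proof.
tfae.
- exact: rotund_Gdelta_diagonal.
- move=> [q qN qG]; exists q => //; exact: Gdelta_diagonal_symmetric.
- by move=> [q qN [rho rhoS rho_small]]; exists q => //; exact: symmetric_star rho_small.
(* In the cycle, (iv) reaches (v) by way of (i). *)
- by move=> /star_cover_rotund; exact: rotund_star_slices.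
- exact: star_slices_rotund.
Qed.
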